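(* Let $G$ be a graph that has a touching triangles representation, and let $u$ and $v$ be two vertices of $G$ joined by an edge. Then $|N_{uv}|\le 3$ and $|E_{uv}|\le 1$.
   Context: A touching triangles representation of a graph $G=(V,E)$ is a set of triangles in the plane with pairwise disjoint interiors, in bijection with $V$, such that two triangles touch non-trivially (their boundaries share a segment of positive length; sharing only a point does not count) if and only if the corresponding vertices are adjacent. For a vertex $u$, $N_u$ denotes the set of vertices adjacent to $u$. For vertices $u,v$, $N_{uv}=N_u\cap N_v$ is the set of common neighbors, and $E_{uv}$ is the set of edges of $G$ with both endpoints in $N_{uv}$ (the edge set of the subgraph induced by $N_{uv}$). *)

(* Defs.v *)
From HB Require Import structures.
From mathcomp Require Import all_boot all_order all_algebra.
From mathcomp Require Import all_classical all_reals all_analysis.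

Set Implicit Arguments.
Unset Strict Implicit.
Unset Printing Implicit Defensive.

Import Order.TTheory GRing.Theory Num.Theory.
Import numFieldNormedType.Exports.

Local Open Scope classical_set_scope.
Local Open Scope ring_scope.

Section Geometry.
Variable R : realType.

Notation plane := 'rV[R]_2.

Definition segment (p q : plane) : set plane :=
  [set z | exists t : R, 0 <= t <= 1 /\ z = (1 - t) *: p + t *: q].

Definition triangle_hull (a b c : plane) : set plane :=
  [set z | exists x y w : R,
    [/\ 0 <= x, 0 <= y, 0 <= w, x + y + w = 1
      & z = x *: a + y *: b + w *: c]].

(* [row_free] says that b - a and c - a are linearly independent, i.e., that
   a, b, c are not collinear: triangles are nondegenerate. *)
Definition is_triangle (A : set plane) : Prop :=
  exists a b c : plane,
    row_free (col_mx (b - a) (c - a)) /\ A = triangle_hull a b c.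

Definition boundary (A : set plane) : set plane := closure A `\` A°.

Definition touch (A B : set plane) : Prop :=
  exists p q : plane, p != q /\ segment p q `<=` boundary A `&` boundary B.

End Geometry.

(* [adj] is the adjacency relation of the graph; it is required to be symmetric
   and irreflexive only where the graph is introduced.
   Injectivity of T makes it a bijection from V onto the set of triangles. *)
Definition has_touching_triangles_rep (R : realType) (V : finType)
    (adj : rel V) : Prop :=
  exists T : V -> set 'rV[R]_2,
    [/\ injective T,
        forall x, is_triangle (T x),
        forall x y, x != y -> (T x)° `&` (T y)° = set0
      & forall x y, x != y -> (adj x y <-> touch (T x) (T y))].

Section Graph.
Variables (V : finType) (adj : rel V).

Definition neighbors (u : V) : {set V} := [set w | adj u w]%SET.

Definition common_neighbors (u v : V) : {set V} :=
  (neighbors u :&: neighbors v)%SET.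

(* Edges are unordered pairs, represented as two-element sets [set x; y]. *)
Definition common_edges (u v : V) : {set {set V}} :=
  [set [set x; y] | x in common_neighbors u v, y in common_neighbors u v
                  & adj x y]%SET.

End Graph.

(* Main.v *)
(* Two touching triangles U and V lie on opposite sides of the line H of their
   common segment, which cuts out facets [a, b] of U and [c, d] of V that overlap.
   A common neighbor has facets along a side of U and along a side of V; by
   convexity the two sides are not both on H, nor one at the left end and one at
   the right end. So it is of one of three kinds:
   - it uses H and a right side: it has a corner at min(b, d), where it fills a
     fixed wedge;
   - it uses H and a left side, symmetrically;
   - it uses the two right sides, or the two left sides. Two right sides force the
     slope s' of the right side of V to be at most the slope s of that of U (X as
     a function of the height), two left sides force t <= t'; as s < t and t' < s',
     only one of these occurs.
   Two triangles of the same kind fill a common wedge, whence at most three common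
   neighbors. Neighbors of the first two kinds do not touch, since if both reached
   as far as the apex of V (or U) they would overlap there; by the same argument
   the third kind cannot touch the kind on the opposite end, unless b = d (or
   a = c), in which case one of the first two kinds does not occur. *)
Require Import Defs.
From HB Require Import structures.
From mathcomp Require Import all_boot all_order all_algebra.
From mathcomp Require Import all_classical all_reals all_analysis.
From mathcomp Require Import ring lra.

Set Implicit Arguments.
Unset Strict Implicit.
Unset Printing Implicit Defensive.

Import Order.TTheory GRing.Theory Num.Theory.
Import numFieldNormedType.Exports.

Local Open Scope classical_set_scope.
Local Open Scope ring_scope.

(** Rewrites the side functions at [p] in terms of [X] and [hV], using the five equations in
    [config]. *)
Ltac expand E p :=
  let e1 := fresh in let e2 := fresh in let e3 := fresh in
  let e4 := fresh in let e5 := fresh in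
  have [e1 e2 e3 e4 e5] := E p; rewrite ?e1 ?e2 ?e3 ?e4 ?e5 {e1 e2 e3 e4 e5}.

Lemma ord3_third (i j : 'I_3) : i != j ->
  exists l, [/\ l != i, l != j & forall n, [\/ n = i, n = j | n = l]].
Proof.
move=> ij.
have [l /andP[li lj]] : exists l : 'I_3, (l != i) && (l != j).
  move: ij; case: i => [[|[|[|//]]] Hi]; case: j => [[|[|[|//]]] Hj] //= _;
  first [by exists (@Ordinal 3 0 isT) | by exists (@Ordinal 3 1 isT) | by exists (@Ordinal 3 2 isT)].
exists l; split=> // n.
have : [|| n == i, n == j | n == l].
  move: ij li lj; case: i => [[|[|[|//]]] Hi]; case: j => [[|[|[|//]]] Hj];
  case: l => [[|[|[|//]]] Hl]; case: n => [[|[|[|//]]] Hn] //.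
by case/or3P=> /eqP; [constructor 1|constructor 2|constructor 3].
Qed.

Lemma ord3_others (i : 'I_3) :
  exists j l, [/\ j != i, l != i, l != j & forall n, [\/ n = i, n = j | n = l]].
Proof.
have [j ji] : exists j : 'I_3, j != i.
  by case: i => [[|[|[|//]]] Hi];
    [exists (@Ordinal 3 1 isT) | exists (@Ordinal 3 0 isT) | exists (@Ordinal 3 0 isT)].
have [] := @ord3_third i j; first by rewrite eq_sym.
by move=> l [li lj H]; exists j, l.
Qed.

(** * Affine functions and barycentric coordinates *)

Section Triangles.
Variable R : realType.
Notation plane := 'rV[R]_2.
Implicit Types (f g : plane -> R) (m : 'I_3 -> plane -> R) (z w p : plane).

Definition affine_fun f :=
  exists al be ga : R, forall z, f z = al * z 0 0 + be * z 0 1 + ga.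

Lemma affine_comb f z w (e : R) : affine_fun f ->
  f ((1 - e) *: z + e *: w) = (1 - e) * f z + e * f w.
Proof. by move=> [a [b [c H]]]; rewrite !H !mxE; ring. Qed.

Lemma affine_comb3 f z1 z2 z3 (x1 x2 x3 : R) : affine_fun f -> x1 + x2 + x3 = 1 ->
  f (x1 *: z1 + x2 *: z2 + x3 *: z3) = x1 * f z1 + x2 * f z2 + x3 * f z3.
Proof.
move=> [a [b [c H]]] x123; rewrite !H !mxE.
have -> : x3 = 1 - x1 - x2 by rewrite -x123; ring.
ring.
Qed.

Lemma affine_continuous f : affine_fun f -> continuous f.
Proof.
move=> [a [b [c H]]].
have -> : f = (fun z => a * z 0 0 + b * z 0 1 + c) by apply/funext.
move=> z.
have C k : {for z, continuous (fun y : 'rV[R]_2 => y 0 k)} by exact: coord_continuous.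
have Z (r : R) : {for z, continuous (fun y : 'rV[R]_2 => r)} by exact: cst_continuous.
exact: (continuousD (continuousD (continuousM (Z a) (C 0)) (continuousM (Z b) (C 1))) (Z c)).
Qed.

(** These coordinates stand for a triangle: it is the region where all [m i] are nonnegative, and
    its facet [i] lies on [m i = 0]. *)
Definition barycentric m := [/\ forall i, affine_fun (m i),
  forall z, \sum_i m i z = 1,
  forall x : 'I_3 -> R, \sum_i x i = 1 -> exists z, forall i, m i z = x i
  & forall z w, (forall i, m i z = m i w) -> z = w].

Lemma sum3 (F : 'I_3 -> R) i j l : j != i -> l != i -> l != j ->
  \sum_n F n = F i + F j + F l.
Proof.
move=> ji li lj; have [] := @ord3_third i j; first by rewrite eq_sym.
move=> l' [_ _ H].
rewrite (bigD1 i) //= (bigD1 j) //= (bigD1 l) /=; last by rewrite li.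
rewrite big1 ?addr0 ?addrA // => n /andP[/andP[ni nj] nl].
case: (H l) (H n) => [E|E|El]; [by rewrite E eqxx in li|by rewrite E eqxx in lj|].
by case=> E; [rewrite E eqxx in ni|rewrite E eqxx in nj|rewrite E El eqxx in nl].
Qed.

Lemma bary_sum3 m i j l z : barycentric m -> j != i -> l != i -> l != j ->
  m l z = 1 - m i z - m j z.
Proof.
by move=> [_ + _ _] ji li lj => /(_ z); rewrite (sum3 _ ji li lj) => <-; ring.
Qed.

Lemma bary_point m i j l (x y : R) : barycentric m -> j != i -> l != i -> l != j ->
  exists z, [/\ m i z = x, m j z = y & m l z = 1 - x - y].
Proof.
move=> [_ _ H _] ji li lj.
have [|z Hz] := H (fun n => if n == i then x else if n == j then y else 1 - x - y).
  by rewrite (sum3 _ ji li lj) eqxx (negbTE ji) eqxx (negbTE li) (negbTE lj); ring.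
exists z; split; rewrite Hz ?eqxx ?(negbTE ji) ?eqxx ?(negbTE li) ?(negbTE lj) //.
Qed.

(** The coefficients are the values of [f] at the three vertices. *)
Lemma bary_expand m i j l : barycentric m -> j != i -> l != i -> l != j ->
  forall f, affine_fun f -> exists al be ga : R,
  forall z, f z = al * m i z + be * m j z + ga * m l z.
Proof.
move=> bm ji li lj f af.
have [va [a1 a2 a3]] := bary_point 1 0 bm ji li lj.
have [vb [b1 b2 b3]] := bary_point 0 1 bm ji li lj.
have [vc [c1 c2 c3]] := bary_point 0 0 bm ji li lj.
exists (f va), (f vb), (f vc) => z.
have [am _ _ inj] := bm.
have s1 : m i z + m j z + m l z = 1 by rewrite (bary_sum3 z bm ji li lj); ring.
have {1}-> : z = m i z *: va + m j z *: vb + m l z *: vc.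
  have [] := @ord3_third i j; first by rewrite eq_sym.
  move=> l' [l'i l'j H].
  have {l'i l'j} H : forall n, [\/ n = i, n = j | n = l].
    suff -> : l = l' by [].
    by case: (H l) => // E; [rewrite E eqxx in li|rewrite E eqxx in lj].
  apply: inj => n; rewrite affine_comb3 //.
  case: (H n) => ->; rewrite ?a1 ?b1 ?c1 ?a2 ?b2 ?c2 ?a3 ?b3 ?c3; ring.
rewrite affine_comb3 //; ring.
Qed.

(** * Overlapping triangles *)

Definition interiors_meet m m' := exists z, forall i, 0 < m i z /\ 0 < m' i z.

(** A small step from [p] towards [q] leads into the interior; [q] itself may lie outside the
    triangle. *)
Definition enters m p q := forall i, 0 <= m i p /\ (m i p = 0 -> 0 < m i q).

Lemma enters_near m p q : barycentric m -> enters m p q ->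
  \forall e \near 0^'+, forall i, 0 < m i ((1 - e) *: p + e *: q).
Proof.
move=> [am _ _ _] H; apply: filter_forall => i.
have [ge0 gt0] := H i.
have [E|N] := eqVneq (m i p) 0.
  near=> e; rewrite affine_comb // E mulr0 add0r mulr_gt0 //; exact: gt0.
have mp : 0 < m i p by rewrite lt_def N.
have B : 0 < m i p + `|m i q| by apply: ltr_pwDl.
near=> e; rewrite affine_comb //.
have e0 : 0 < e by near: e; exact: nbhs_right_gt.
have e1 : e * (m i p + `|m i q|) < m i p.
  rewrite -ltr_pdivlMr //; near: e; apply: nbhs_right_lt; exact: divr_gt0.
have : - `|m i q| <= m i q by rewrite lerNl -normrN ler_norm.
nra.
Unshelve. all: by end_near. Qed.

(** One step, small enough for both triangles, ends in both interiors. All overlaps below are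
    obtained in this way. *)
Lemma enters_meet m m' p q : barycentric m -> barycentric m' ->
  enters m p q -> enters m' p q -> interiors_meet m m'.
Proof.
move=> bm bm' /(enters_near bm) H /(enters_near bm') H'.
have [e [He He']] := @filter_ex _ (0^'+ : set_system R) _ _ (filterI H H').
by exists ((1 - e) *: p + e *: q) => i; split.
Qed.

(** * Barycentric coordinates and topology of a triangle *)

Lemma mul_row2_col (u p q : plane) :
  u *m (col_mx p q : 'M[R]_2) = u 0 0 *: p + u 0 1 *: q.
Proof.
have E : u = row_mx (u 0 0)%:M (u 0 1)%:M :> 'M[R]_(1, 1 + 1).
  rewrite -[LHS](@hsubmxK _ 1 1 1) [lsubmx _]mx11_scalar [rsubmx _]mx11_scalar !mxE.
  by congr (row_mx (u _ _)%:M (u _ _)%:M); apply: val_inj.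
by rewrite {1}E (@mul_row_col _ 1 1 1 2) !mul_scalar_mx.
Qed.

Lemma sum_ord3 (F : 'I_3 -> R) : \sum_i F i = F 0 + F 1 + F (@Ordinal 3 2 isT).
Proof. exact: sum3. Qed.

(** The matrix [M] with rows [b - a] and [c - a] is invertible, so [z - a = u *m M] has a unique
    solution; the coordinates are [1 - u0 - u1], [u0] and [u1]. *)
Lemma triangle_barycentric (A : set plane) : is_triangle A ->
  exists m, barycentric m /\ A = [set z | forall i, 0 <= m i z].
Proof.
move=> [a [b [c [free ->]]]].
pose M : 'M[R]_2 := col_mx (b - a) (c - a).
have uM : M \in unitmx by rewrite -row_free_unit.
pose u z := (z - a) *m invmx M.
have uK z : z = a + u z 0 0 *: (b - a) + u z 0 1 *: (c - a).
  by rewrite -addrA -mul_row2_col mulmxKV // addrC subrK.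
have Ku x y : u (a + x *: (b - a) + y *: (c - a)) = \row_k (if k == 0 then x else y).
  rewrite /u [in X in X *m _]addrC !addrA addNr add0r.
  set r := \row__ _.
  have -> : x *: (b - a) + y *: (c - a) = r *m M.
    by rewrite mul_row2_col !mxE.
  by rewrite mulmxK.
have au k : affine_fun (fun z => u z 0 k).
  exists (invmx M 0 k), (invmx M 1 k), (- (a 0 0 * invmx M 0 k + a 0 1 * invmx M 1 k)) => z.
  rewrite /u mxE !big_ord_recl big_ord0 !mxE addr0.
  have -> : lift ord0 ord0 = 1 :> 'I_2 by apply: val_inj.
  by ring.
pose m (i : 'I_3) z : R := if i == 0 then 1 - u z 0 0 - u z 0 1
  else if i == 1 then u z 0 0 else u z 0 1.
pose i2 : 'I_3 := @Ordinal 3 2 isT.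
exists m; split.
  split.
  - move=> i; rewrite /m; case: (i == 0); last by case: (i == 1); exact: au.
    have [a1 [b1 [c1 H1]]] := au 0; have [a2 [b2 [c2 H2]]] := au 1.
    exists (- a1 - a2), (- b1 - b2), (1 - c1 - c2) => z.
    by rewrite H1 H2; ring.
  - by move=> z; rewrite sum_ord3 /m /=; ring.
  - move=> x; rewrite sum_ord3 => x1.
    exists (a + x 1 *: (b - a) + x i2 *: (c - a)) => i.
    rewrite /m Ku !mxE /=.
    case: ifPn => [/eqP ->|i0]; first by rewrite -x1; ring.
    case: ifPn => [/eqP -> //|i1].
    congr x; apply: val_inj.
    by move: i0 i1; case: i => [[|[|[|//]]] Hi].
  - move=> z w H; rewrite (uK z) (uK w).
    by have := H 1; have := H i2; rewrite /m /= => -> ->.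
apply/seteqP; split => z /=.
  move=> [x [y [t [x0 y0 t0 s ->]]]] i.
  have -> : x *: a + y *: b + t *: c = a + y *: (b - a) + t *: (c - a).
    have -> : x = 1 - y - t by rewrite -s; ring.
    by apply/rowP => k; rewrite !mxE; ring.
  rewrite /m Ku !mxE /=.
  by case: ifP => _; [lra | case: ifP].
move=> H; exists (m 0 z), (m 1 z), (m i2 z); split=> //.
  by rewrite /m /=; ring.
rewrite [LHS]uK /m /=.
by apply/rowP => k; rewrite !mxE; ring.
Qed.

Lemma triangle_interior m (A : set plane) z : barycentric m ->
  A = [set z | forall i, 0 <= m i z] -> (forall i, 0 < m i z) -> A° z.
Proof.
move=> [am _ _ _] -> zpos.
have : nbhs z [set w | forall i, 0 < m i w].
  apply: (@filter_forall _ _ (fun i w => 0 < m i w) _ (nbhs_filter z)) => i.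
  exact: (@cvgr_gt R _ (nbhs z) (nbhs_filter z) (m i) (m i z)
            (@affine_continuous _ (am i) z) 0 (zpos i)).
by apply: filterS => w H i; exact: ltW.
Qed.

Lemma triangle_closed m (A : set plane) : barycentric m ->
  A = [set z | forall i, 0 <= m i z] -> closed A.
Proof.
move=> [am _ _ _] ->.
have -> : [set z | forall i, 0 <= m i z] =
    \bigcap_(i in [set: 'I_3]) (m i @^-1` [set x | 0 <= x]).
  by apply/seteqP; split => z /= H i; [move=> _; exact: H | exact: (H i)].
apply: closed_bigI => i _; apply: preimage_closed; last exact: closed_ge.
by move=> z _; exact: affine_continuous.
Qed.

(** * From touching to abutting triangles *)

Lemma boundary_facet m (A : set plane) z : barycentric m ->
  A = [set z | forall i, 0 <= m i z] -> boundary A z ->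
  (forall i, 0 <= m i z) /\ exists i, m i z = 0.
Proof.
move=> bm EA [/(triangle_closed bm EA) Az nint].
have pos i : 0 <= m i z by move: Az; rewrite EA.
split=> //; apply: contrapT => H; apply: nint; apply: (triangle_interior bm EA) => i.
rewrite lt_def pos andbT; apply/eqP => E; apply: H; by exists i.
Qed.

(** Some coordinate vanishes at the midpoint, hence at both ends, where it is nonnegative. If a
    second one did too, [p] and [q] would be the same vertex. *)
Lemma boundary_segment m (A : set plane) p q : barycentric m ->
  A = [set z | forall i, 0 <= m i z] -> p != q -> segment p q `<=` boundary A ->
  exists i, [/\ m i p = 0, m i q = 0 &
   forall j, j != i -> 0 < m j (2^-1 *: p + 2^-1 *: q)].
Proof.
move=> bm EA pq S.
have [pge _] : (forall i, 0 <= m i p) /\ exists i, m i p = 0.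
  by apply: (boundary_facet bm EA); apply: S; exists 0; split; [lra|rewrite subr0 scale1r scale0r addr0].
have [qge _] : (forall i, 0 <= m i q) /\ exists i, m i q = 0.
  by apply: (boundary_facet bm EA); apply: S; exists 1; split; [lra|rewrite subrr scale1r scale0r add0r].
have half : 1 - 2^-1 = 2^-1 :> R by lra.
have mid i : m i (2^-1 *: p + 2^-1 *: q) = 2^-1 * m i p + 2^-1 * m i q.
  by rewrite -{1}half affine_comb ?half //; case: bm.
have [_ [i mi]] : (forall i, 0 <= m i (2^-1 *: p + 2^-1 *: q)) /\
    exists i, m i (2^-1 *: p + 2^-1 *: q) = 0.
  apply: (boundary_facet bm EA); apply: S; exists 2^-1; split; first lra.
  by rewrite half.
have zero j : m j (2^-1 *: p + 2^-1 *: q) = 0 -> m j p = 0 /\ m j q = 0.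
  by rewrite mid; have := pge j; have := qge j; lra.
have [ip iq] := zero _ mi.
exists i; split=> // j ji.
rewrite lt_def; apply/andP; split; last first.
  by rewrite mid; have := pge j; have := qge j; lra.
apply/eqP => /zero [jp jq]; case/eqP: pq.
have [l [lj li H]] := ord3_third ji.
have [_ _ _ inj] := bm; apply: inj => n.
have [->|->|->] := H n; rewrite ?ip ?iq ?jp ?jq //.
by rewrite !(bary_sum3 _ bm ji li lj) ip iq jp jq.
Qed.

(* The triangles lie on opposite sides of the line carrying their facets [i]
   and [j], and [p] is a relative interior point of both facets. *)
Definition abut m m' := exists i j k p, [/\ 0 < k,
  forall z, m i z = - k * m' j z, m i p = 0,
  forall n, n != i -> 0 < m n p & forall n, n != j -> 0 < m' n p].

(** Both [f] and [m i] vanish on the line through [p] and [q], and [m i] is not constant. *)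
Lemma affine_prop m i f p q : barycentric m -> affine_fun f -> p != q ->
  m i p = 0 -> m i q = 0 -> f p = 0 -> f q = 0 ->
  exists k, forall z, f z = k * m i z.
Proof.
move=> bm af pq ip iq fp fq.
have [j [l [ji li lj H]]] := ord3_others i.
have [al [be [ga E]]] := bary_expand bm ji li lj af.
have El z := bary_sum3 z bm ji li lj.
have jpq : m j p != m j q.
  apply: contra_neq pq => jpq; have [_ _ _ inj] := bm; apply: inj => n.
  by have [->|->|->] := H n; rewrite ?El ?ip ?iq ?jpq.
move: fp fq; rewrite !E !El ip iq => fp fq.
have D : (be - ga) * (m j p - m j q) = 0 by move: fp fq; lra.
move/eqP: D; rewrite mulf_eq0 !subr_eq0 (negbTE jpq) orbF => /eqP bg.
have g0 : ga = 0 by move: fp; rewrite bg; lra.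
by exists al => z; rewrite E bg g0; ring.
Qed.

Lemma touch_abut m m' (A B : set plane) : barycentric m -> barycentric m' ->
  A = [set z | forall i, 0 <= m i z] -> B = [set z | forall i, 0 <= m' i z] ->
  ~ interiors_meet m m' -> touch A B -> abut m m'.
Proof.
move=> bm bm' EA EB disj [p [q [pq S]]].
have [i [ip iq ipos]] := boundary_segment bm EA pq (fun z Hz => (S z Hz).1).
have [j [jp jq jpos]] := boundary_segment bm' EB pq (fun z Hz => (S z Hz).2).
have [am _ _ _] := bm; have [am' _ _ _] := bm'.
have [k Hk] := affine_prop bm' (am i) pq jp jq ip iq.
set c := 2^-1 *: p + 2^-1 *: q in ipos jpos.
have half : 1 - 2^-1 = 2^-1 :> R by lra.
have ic : m i c = 0 by rewrite /c -{1}half affine_comb // ip iq; ring.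
have jc : m' j c = 0 by rewrite /c -{1}half affine_comb // jp jq; ring.
have [j1 [l1 [ji li lj H]]] := ord3_others i.
have [z [zi _ _]] := bary_point 1 0 bm ji li lj.
exists i, j, (- k), c; split=> //; last by move=> y; rewrite opprK.
(* If [k >= 0], both triangles lie on the same side of the line, and a step from the midpoint [c]
   towards [z] enters both. *)
rewrite oppr_gt0 ltNge; apply/negP => k0; apply: disj.
have mz : 0 < k * m' j z by rewrite -Hk zi.
have kpos : 0 < k by rewrite lt_def k0 andbT; apply/eqP => k00; rewrite k00 mul0r ltxx in mz.
apply: (enters_meet (p := c) (q := z)) => // n.
- have [->|ni] := eqVneq n i; first by rewrite ic zi.
  by split; [exact/ltW/ipos|have := ipos n ni => + E; rewrite E ltxx].
have [->|nj] := eqVneq n j; first by rewrite jc; split=> // _; rewrite -(pmulr_rgt0 _ kpos).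
by split; [exact/ltW/jpos|have := jpos n nj => + E; rewrite E ltxx].
Qed.

(* A triangle lies in [g >= 0] and has a facet on [g = 0], which overlaps the
   facet on [g = 0] of the triangle [g <= 0, h <= 0, h' <= 0]. *)
Definition contact m (g h h' : plane -> R) := exists i k p, [/\ 0 < k,
  forall z, m i z = k * g z, g p = 0, forall n, n != i -> 0 < m n p
  & h p < 0 /\ h' p < 0].

(** * Points and corners of a triangle in contact with given lines *)

(** The point [p] lies in the triangle and is not a vertex of it. *)
Definition at_most_one_zero m p := exists i, 0 <= m i p /\ forall n, n != i -> 0 < m n p.

Definition tangent m m' := exists p, at_most_one_zero m p /\ at_most_one_zero m' p.

Lemma at_most_one_zero_ge0 m p : at_most_one_zero m p -> forall n, 0 <= m n p.
Proof.
by move=> [i [ip H]] n; have [->//|/H/ltW] := eqVneq n i.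
Qed.

Lemma at_most_one_zero_gt0 m p i j : at_most_one_zero m p -> i != j -> m i p = 0 -> 0 < m j p.
Proof.
move=> [l [lp H]] ij ip; have [jl|/H //] := eqVneq j l.
by have := H i; rewrite -jl ip ltxx => /(_ ij).
Qed.

Lemma abut_sym m m' : abut m m' -> abut m' m.
Proof.
move=> [i [j [k [p [k0 H ip Hi Hj]]]]]; exists j, i, k^-1, p; split=> //.
- by rewrite invr_gt0.
- by move=> z; rewrite H; field; rewrite gt_eqF.
- have := H p; rewrite ip => /esym/eqP; rewrite mulf_eq0 oppr_eq0 gt_eqF //=.
  by move/eqP.
Qed.

Lemma abut_tangent m m' : abut m m' -> tangent m m'.
Proof.
move=> /[dup] /abut_sym [i' [j' [k' [p' [k0' H' ip' Hi' Hj']]]]].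
move=> [i [j [k [p [k0 H ip Hi Hj]]]]]; exists p; split.
  by exists i; rewrite ip.
exists j; split=> //.
have := H p; rewrite ip => /esym/eqP; rewrite mulf_eq0 oppr_eq0 gt_eqF //=.
by move/eqP=> ->.
Qed.

Lemma contact_point m g h h' : contact m g h h' ->
  exists p, [/\ at_most_one_zero m p, g p = 0, h p < 0 & h' p < 0].
Proof.
move=> [i [k [p [k0 H gp Hp [hp hp']]]]]; exists p; split=> //.
by exists i; rewrite H gp mulr0.
Qed.

Lemma contact_ge0 m g h h' p : contact m g h h' -> at_most_one_zero m p -> 0 <= g p.
Proof.
by move=> [i [k [q [k0 H _ _ _]]]] /at_most_one_zero_ge0/(_ i); rewrite H pmulr_rge0.
Qed.

(** The point [z] only serves to show that the lines [f = 0] and [g = 0] carry different facets. *)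
Lemma two_facets m f f1 f2 g g1 g2 z : barycentric m ->
  contact m f f1 f2 -> contact m g g1 g2 -> f z = 0 -> g z != 0 ->
  exists i j l k k', [/\ [/\ j != i, l != i, l != j, 0 < k & 0 < k'],
   forall z, m i z = k * f z, forall z, m j z = k' * g z,
   forall z, m l z = 1 - k * f z - k' * g z & forall n, [\/ n = i, n = j | n = l]].
Proof.
move=> bm [i [k [p [k0 H gp Hp _]]]] [j [k' [p' [k0' H' gp' Hp' _]]]] fz gz.
have ji : j != i.
  apply: contra_neq gz => ji.
  move: (H' z); rewrite ji H fz mulr0 => /esym/eqP.
  by rewrite mulf_eq0 gt_eqF //= => /eqP.
have [] := @ord3_third i j; first by rewrite eq_sym.
move=> l [li lj Hn]; exists i, j, l, k, k'; split=> // w.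
by rewrite (bary_sum3 _ bm ji li lj) H H'.
Qed.

(** The point [p] is the vertex between the two facets, where the triangle fills the wedge [f >= 0],
    [g >= 0]. This wedge does not depend on [m], so two such triangles overlap. *)
Lemma corner_enters m f f1 f2 g g1 g2 z p q : barycentric m ->
  contact m f f1 f2 -> contact m g g1 g2 -> f z = 0 -> g z != 0 ->
  f p = 0 -> g p = 0 -> 0 < f q -> 0 < g q -> enters m p q.
Proof.
move=> bm cf cg fz gz fp gp fq gq.
have [i [j [l [k [k' [[_ _ _ k0 k0'] Hi Hj Hl H]]]]]] := two_facets bm cf cg fz gz.
move=> n; have [->|->|->] := H n.
- by rewrite !Hi fp mulr0; split=> // _; exact: mulr_gt0.
- by rewrite !Hj gp mulr0; split=> // _; exact: mulr_gt0.
- by rewrite !Hl fp gp !mulr0 !subr0; split=> // /eqP; rewrite oner_eq0.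
Qed.

(** * The configuration of two abutting triangles and its symmetries *)

(** For U and V: the side on the common line, the right side and the left side, each function being
    positive beyond its side. *)
Record sides := Sides { hU : plane -> R; rU : plane -> R; lU : plane -> R;
                        hV : plane -> R; rV : plane -> R; lV : plane -> R }.

Definition mirror S := Sides (hU S) (lU S) (rU S) (hV S) (lV S) (rV S).
Definition swap S := Sides (hV S) (rV S) (lV S) (hU S) (rU S) (lU S).

(* In the affine coordinates [(X, hV)] two triangles U and V abut along the line
   [hV = 0]: U is [hV >= 0, a + t hV <= X <= b + s hV] and
   V is [hV <= 0, c + t' hV <= X <= d + s' hV]. *)
Definition config X S := exists a b s t c d s' t' : R,
  [/\ [/\ affine_fun X, affine_fun (hV S),
      forall x y, exists z, X z = x /\ hV S z = y
      & forall z w, X z = X w -> hV S z = hV S w -> z = w],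
      forall z, [/\ hU S z = - hV S z,
        rU S z = X z - b - s * hV S z, lU S z = a + t * hV S z - X z,
        rV S z = X z - d - s' * hV S z & lV S z = c + t' * hV S z - X z],
      [/\ a < b, s < t, c < d & t' < s'] & a < d /\ c < b].

Lemma affine_opp f : affine_fun f -> affine_fun (\- f).
Proof.
by move=> [a [b [c H]]]; exists (- a), (- b), (- c) => z; rewrite /= H; ring.
Qed.

Lemma config_mirror X S : config X S -> config (\- X) (mirror S).
Proof.
move=> [a [b [s [t [c [d [s' [t' [[aX aH sj ij] E [ab st cd ts] [ad cb]]]]]]]]]].
exists (- b), (- a), (- t), (- s), (- d), (- c), (- t'), (- s').
split; last by split; lra.
- split; [exact: affine_opp|by []| |].
    by move=> x y; have [z [z1 z2]] := sj (- x) y; exists z; rewrite /= z1 opprK.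
  by move=> z w /= /oppr_inj; exact: ij.
- move=> z; have [E1 E2 E3 E4 E5] := E z.
  by split=> //=; rewrite ?E2 ?E3 ?E4 ?E5 //; ring.
- by split; lra.
Qed.

(** The height changes sign, and with it all slopes; left and right are kept. *)
Lemma config_swap X S : config X S -> config X (swap S).
Proof.
move=> [a [b [s [t [c [d [s' [t' [[aX aH sj ij] E [ab st cd ts] [ad cb]]]]]]]]]].
exists c, d, (- s'), (- t'), a, b, (- s), (- t).
have EU z : hU S z = - hV S z by have [] := E z.
split; last by split; lra.
- split=> //.
  + suff -> : hV (swap S) = \- hV S by exact: affine_opp.
    exact/funext.
  + by move=> x y; have [z [z1 z2]] := sj x (- y); exists z; rewrite /= EU z2 opprK.
  by move=> z w /= Xz; rewrite !EU => /oppr_inj; exact: ij.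
- move=> z; have [E1 E2 E3 E4 E5] := E z.
  by split=> //=; rewrite ?E1 ?E2 ?E3 ?E4 ?E5 ?opprK //; ring.
- by split; lra.
Qed.

(** * Kinds of common neighbors, and uniqueness within each kind *)

(** One facet cannot face both sides of the line, and two different facets cannot lie on one
    line. *)
Lemma contact_hUhV X S m : config X S ->
  contact m (hU S) (rU S) (lU S) -> contact m (hV S) (rV S) (lV S) -> False.
Proof.
move=> [a [b [s [t [c [d [s' [t' [[aX aH sj ij] E _ _]]]]]]]]].
move=> [i [k [p [k0 H gp Hp _]]]] [j [k' [p' [k0' H' gp' Hp' _]]]].
have EU z : hU S z = - hV S z by have [] := E z.
have [ji|/Hp] := eqVneq j i.
  have [z [_ z1]] := sj 0 1.
  by move: (H z) (H' z); rewrite EU ji z1; lra.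
by rewrite H'; move: gp; rewrite EU => /eqP; rewrite oppr_eq0 => /eqP ->; rewrite mulr0 ltxx.
Qed.

(** The affine function [b - c + (s - t') * y] of the height is nonpositive at [p] above the line
    and at [q] below it, hence at height 0, against [c < b]. *)
Lemma contact_rUlV X S m : config X S ->
  contact m (rU S) (hU S) (lU S) -> contact m (lV S) (hV S) (rV S) -> False.
Proof.
move=> [a [b [s [t [c [d [s' [t' [[aX aH sj ij] E [ab st cd ts] [ad cb]]]]]]]]]] c1 c2.
have [p [ap gp hp _]] := contact_point c1.
have [q [aq gq hq _]] := contact_point c2.
have := contact_ge0 c1 aq; have := contact_ge0 c2 ap; move: gp hp gq hq.
expand E p; expand E q.
set y := hV S p; set y' := hV S q => xp yp xq yq.
have -> : X p = b + s * y by lra.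
have -> : X q = c + t' * y' by lra.
nra.
Qed.

(* [LR] and [NR] are the common neighbors of U and V at their right end that have,
   respectively do not have, a facet on the line [hV = 0]; those at the left end
   are obtained with [mirror S]. *)
Definition LR S m :=
  contact m (hU S) (rU S) (lU S) /\ contact m (rV S) (hV S) (lV S) \/
  contact m (hV S) (rV S) (lV S) /\ contact m (rU S) (hU S) (lU S).
Definition NR S m :=
  contact m (rU S) (hU S) (lU S) /\ contact m (rV S) (hV S) (lV S).

Lemma LR_swap S m : LR S m -> LR (swap S) m.
Proof. by case; [right|left]. Qed.

Lemma NR_swap S m : NR S m -> NR (swap S) m.
Proof. by case. Qed.

Lemma NR_NL X S m m' : config X S -> NR S m -> NR (mirror S) m' -> False.
Proof.
move=> [a [b [s [t [c [d [s' [t' [_ E [ab st cd ts] [ad cb]]]]]]]]]] /= [c1 c2] /= [c3 c4].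
have [p [ap gp hp _]] := contact_point c1.
have [q [aq gq hq _]] := contact_point c2.
have [p' [ap' gp' hp' _]] := contact_point c3.
have [q' [aq' gq' hq' _]] := contact_point c4.
have := contact_ge0 c1 aq; have := contact_ge0 c2 ap.
have := contact_ge0 c3 aq'; have := contact_ge0 c4 ap'.
move: gp hp gq hq gp' hp' gq' hq' => /=.
expand E p; expand E q.
expand E p'; expand E q'.
move: (hV S p) (hV S q) (hV S p') (hV S q') => y1 y2 y3 y4.
move=> e1 h1 e2 h2 e3 h3 e4 h4 I1 I2 I3 I4.
(* Subtract the inequalities [rV p >= 0] and [rU q >= 0], where [p] is above the line and [q] below
   it; likewise at the left end. *)
have F1 : (s' - s) * (y1 - y2) <= 0 by nra.
have F2 : (t - t') * (y3 - y4) <= 0 by nra.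
have G1 : s' <= s by nra.
have G2 : t <= t' by nra.
lra.
Qed.

(* The kind of contact with the line [hV = 0] is determined by the order of the
   right ends [b] and [d] of the facets of U and V. *)
Lemma LR_unique X S m m' : config X S -> barycentric m -> barycentric m' ->
  LR S m -> LR S m' -> interiors_meet m m'.
Proof.
wlog [c1 c2] : X S / contact m (hU S) (rU S) (lU S) /\ contact m (rV S) (hV S) (lV S).
  move=> W C bm bm' [H H'|[H1 H2] H']; first by apply: (W X S) => //; left.
  apply: (W X (swap S)) => //; [exact: config_swap|by left|exact: LR_swap].
move=> C bm bm' _.
have [a [b [s [t [c [d [s' [t' [[_ _ sj _] E [ab st cd ts] [ad cb]]]]]]]]]] := C.
have [p [ap gp hp _]] := contact_point c1.
(* On the line, [p] is left of [b] and not left of [d]. The other alternative of [LR] for [m'] would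
   give [b < d] in the same way. *)
have db : d < b.
  move: (contact_ge0 c2 ap) gp hp; expand E p.
  move=> r0 e h; have y0 : hV S p = 0 by lra.
  by move: r0 h; rewrite y0; lra.
case=> [[c1' c2']|[c3 c4]]; last first.
  have [q [aq gq hq _]] := contact_point c3.
  move: (contact_ge0 c4 aq) gq hq; expand E q.
  move=> r0 e h; have y0 : hV S q = 0 by lra.
  by move: r0 h; rewrite y0; lra.
(* The corner is [z0], the right end of V's facet; [z1] lies inside the wedge, and [z2] tells the
   two lines apart. *)
have [z0 [x0 y0]] := sj d 0.
have [z1 [x1 y1]] := sj (d + 1 - s') (-1).
have [z2 [x2 y2]] := sj (d + 1) 0.
have [e1 _ _ e2 _] := E z0; have [e3 _ _ e4 _] := E z1; have [e5 _ _ e6 _] := E z2.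
have f0 : hU S z0 = 0 by lra.
have g0 : rV S z0 = 0 by rewrite e2 x0 y0; ring.
have f1 : 0 < hU S z1 by lra.
have g1 : 0 < rV S z1 by rewrite e4 x1 y1; lra.
have f2 : hU S z2 = 0 by lra.
have g2 : rV S z2 != 0 by rewrite gt_eqF // e6 x2 y2; lra.
apply: (enters_meet (p := z0) (q := z1)) => //.
  exact: (corner_enters bm c1 c2 f2 g2).
exact: (corner_enters bm' c1' c2' f2 g2).
Qed.

(** A coordinate that vanishes strictly between two points of the triangle vanishes at both. *)
Lemma enters_segment m p q r w (e : R) : barycentric m ->
  at_most_one_zero m p -> at_most_one_zero m q ->
  0 < e < 1 -> r = (1 - e) *: p + e *: q ->
  (forall n, m n p = 0 -> 0 < m n w) -> enters m r w.
Proof.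
move=> [am _ _ _] /at_most_one_zero_ge0 ap /at_most_one_zero_ge0 aq /andP[e0 e1] -> H n.
rewrite affine_comb //; have := ap n; have := aq n => qn pn; split.
  by apply: addr_ge0; apply: mulr_ge0 => //; lra.
by move=> Z; apply: H; nra.
Qed.

Lemma NR_unique X S m m' : config X S -> barycentric m -> barycentric m' ->
  NR S m -> NR S m' -> interiors_meet m m'.
Proof.
move=> [a [b [s [t [c [d [s' [t' [[aX aH sj ij] E [ab st cd ts] [ad cb]]]]]]]]]].
move=> bm bm' [c1 c2] [c1' c2'].
(* [d - b + (s' - s) * y] is the horizontal offset, at height [y], from the right side line of U to
   that of V. *)
have slope m0 : NR S m0 -> exists y y', [/\ 0 < y, y' < 0,
    d - b + (s' - s) * y <= 0 & 0 <= d - b + (s' - s) * y'].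
  move=> [k1 k2].
  have [p [ap gp hp _]] := contact_point k1.
  have [q [aq gq hq _]] := contact_point k2.
  exists (hV S p), (hV S q).
  have := contact_ge0 k1 aq; have := contact_ge0 k2 ap; move: gp hp gq hq.
  expand E p; expand E q.
  by move=> *; split; lra.
have [y [y' [y0 y0' D1 D2]]] := slope m (conj c1 c2).
(* Parallel right sides are collinear: the neighbor's facet then runs along both and contains [z0],
   their common end at height 0. *)
have [/eqP|ss] := eqVneq s' s.
  rewrite -subr_eq0 => /eqP ss0.
  have ss : s' = s by lra.
  have db : d = b by move: D1 D2; rewrite ss0; lra.
  have RR z : rV S z = rU S z by have [_ -> _ -> _] := E z; rewrite ss db.
  have [z0 [x0 h0]] := sj b 0.
  have [w [xw hw]] := sj (b + 1) 0.
  suff En m0 : barycentric m0 -> NR S m0 -> enters m0 z0 w.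
    by apply: (enters_meet (p := z0) (q := w)) => //; apply: En.
  move=> bm0 [[i [k [p [k0 Hi gp Hp [hp _]]]]] k2].
  have [q [aq gq hq _]] := contact_point k2.
  have mi : m0 i p = 0 by rewrite Hi gp mulr0.
  move: gp hp gq hq; rewrite RR.
  have [-> -> _ _ _] := E p; have [_ -> _ _ _] := E q => gp hp gq hq.
  pose e := hV S p / (hV S p - hV S q).
  have ne : hV S p - hV S q != 0 by rewrite gt_eqF //; lra.
  have pq0 : 0 < hV S p - hV S q by lra.
  apply: (enters_segment (p := p) (q := q) (e := e)) => //.
  - by exists i; rewrite mi.
  - apply/andP; split; first by apply: divr_gt0; lra.
    by rewrite ltr_pdivrMr //; lra.
  - have h : (1 - e) * hV S p + e * hV S q = 0 by rewrite /e; field.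
    apply: ij; rewrite affine_comb //; last by rewrite h0 h.
    have -> : X p = b + s * hV S p by lra.
    have -> : X q = b + s * hV S q by lra.
    rewrite x0; transitivity (b + s * ((1 - e) * hV S p + e * hV S q)); last by ring.
    by rewrite h; ring.
  - move=> n np; have [->|/Hp] := eqVneq n i; last by rewrite np ltxx.
    rewrite Hi; apply: mulr_gt0 => //; have [_ -> _ _ _] := E w.
    by rewrite xw hw; lra.
have s0 : s' - s != 0 by rewrite subr_eq0.
(* The height at which the two right side lines cross, which is the corner of the neighbor. *)
pose y1 := (b - d) / (s' - s).
have ey1 : (s' - s) * y1 = b - d by rewrite /y1; field.
have [z0 [x0 h0]] := sj (b + s * y1) y1.
have [z1 [x1 h1]] := sj (b + s * y1 + 1) y1.
have [z2 [x2 h2]] := sj (b + s * (y1 + 1)) (y1 + 1).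
have [_ e1 _ e2 _] := E z0; have [_ e3 _ e4 _] := E z1; have [_ e5 _ e6 _] := E z2.
have f0 : rU S z0 = 0 by rewrite e1 x0 h0; ring.
have g0 : rV S z0 = 0 by rewrite e2 x0 h0; lra.
have f1 : 0 < rU S z1 by rewrite e3 x1 h1; lra.
have g1 : 0 < rV S z1 by rewrite e4 x1 h1; lra.
have f2 : rU S z2 = 0 by rewrite e5 x2 h2; ring.
have g2 : rV S z2 != 0.
  have -> : rV S z2 = - (s' - s) by rewrite e6 x2 h2; lra.
  by rewrite oppr_eq0.
apply: (enters_meet (p := z0) (q := z1)) => //.
  exact: (corner_enters bm c1 c2 f2 g2).
exact: (corner_enters bm' c1' c2' f2 g2).
Qed.

(** * Tangent neighbors of different kinds overlap at an apex *)

(* [q] is the apex of V. *)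
Lemma apex_enters X S m p q w : config X S -> barycentric m ->
  contact m (hU S) (rU S) (lU S) -> contact m (rV S) (hV S) (lV S) ->
  at_most_one_zero m p -> 0 <= lV S p -> rV S q = 0 -> lV S q = 0 ->
  0 < rV S w -> enters m q w.
Proof.
move=> [a [b [s [t [c [d [s' [t' [[_ _ sj _] E [ab st cd ts] [ad cb]]]]]]]]]].
move=> bm c1 c2 ap lp rq lq rw.
have [z2 [x2 y2]] := sj (d + 1) 0.
have [e5 _ _ e6 _] := E z2.
have f2 : hU S z2 = 0 by lra.
have g2 : rV S z2 != 0 by rewrite gt_eqF // e6 x2 y2; lra.
have [i [j [l [k [k' [[ji li lj k0 k0'] Hi Hj Hl H]]]]]] := two_facets bm c1 c2 f2 g2.
have rp := contact_ge0 c2 ap.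
have lp0 := at_most_one_zero_ge0 ap l.
have jl0 : rV S p = 0 -> 0 < m l p.
  by move=> r0; apply: (at_most_one_zero_gt0 (i := j) ap); rewrite ?Hj ?r0 ?mulr0 // eq_sym.
rewrite Hl in lp0; rewrite Hl in jl0.
have [p1 _ _ p2 p3] := E p; have [q1 _ _ q2 q3] := E q.
(* As [rV] and [lV] are nonnegative at [p], this point is no higher than the apex. *)
have yq : hV S q < 0 by nra.
have yp : hV S p <= hV S q by nra.
(* The third coordinate at [q] is at least that at [p] plus [k' * rV S p]; one of these two terms is
   positive because [p] is not a vertex. *)
have lq0 : 0 < 1 - k * hU S q.
  have [r0|rn] := eqVneq (rV S p) 0.
    by have := jl0 r0; rewrite r0 p1 q1; nra.
  have r0 : 0 < rV S p by rewrite lt_def rn.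
  rewrite q1; rewrite p1 in lp0.
  have : 0 < k' * rV S p by exact: mulr_gt0.
  nra.
have iq0 : 0 < k * hU S q by apply: mulr_gt0 => //; lra.
move=> n; have [->|->|->] := H n.
- by rewrite Hi; split; [exact: ltW|move=> Z; rewrite Z ltxx in iq0].
- by rewrite !Hj rq mulr0; split=> // _; exact: mulr_gt0.
- by rewrite Hl rq mulr0 subr0; split; [exact: ltW|move=> Z; rewrite Z ltxx in lq0].
Qed.

Lemma apex_exists X S : config X S -> exists q w,
  [/\ rV S q = 0, lV S q = 0, 0 < rV S w & 0 < lV S w].
Proof.
move=> [a [b [s [t [c [d [s' [t' [[_ _ sj _] E [ab st cd ts] [ad cb]]]]]]]]]].
pose y := (d - c) / (t' - s').
have ne : t' - s' != 0 by rewrite lt_eqF //; lra.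
have ey : (t' - s') * y = d - c by rewrite /y; field.
have [q [x0 h0]] := sj (d + s' * y) y.
(* One unit below the apex, midway between the extended sides of V. *)
have [w [x1 h1]] := sj (d + s' * y - (s' + t') / 2) (y - 1).
exists q, w; have [_ _ _ -> ->] := E q; have [_ _ _ -> ->] := E w.
by rewrite x0 x1 h0 h1; split; lra.
Qed.

(** If both neighbors have a facet facing U on the common line, the tangency point shows that both
    reach the apex of V. Otherwise that point would lie on the line, with [X] at least [d] and at
    most [a]. *)
Lemma LR_LL X S m m' : config X S -> barycentric m -> barycentric m' ->
  LR S m -> LR (mirror S) m' -> tangent m m' -> interiors_meet m m'.
Proof.
wlog [c1 c2] : X S / contact m (hU S) (rU S) (lU S) /\ contact m (rV S) (hV S) (lV S).
  move=> W C bm bm' [H H'|[H1 H2] H']; first by apply: (W X S) => //; left.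
  apply: (W X (swap S)) => //; [exact: config_swap|by left|exact: (@LR_swap (mirror S))].
move=> C bm bm' _ L [p [ap ap']].
have C' := config_mirror C.
case: L => [[c3 c4]|[c3 c4]].
  have [q [w [rq lq rw lw]]] := apex_exists C.
  apply: (enters_meet (p := q) (q := w)) => //.
    exact: (apex_enters C bm c1 c2 ap (contact_ge0 c4 ap') rq lq rw).
  exact: (apex_enters C' bm' _ _ ap' (contact_ge0 c2 ap) lq rq lw).
have [a [b [s [t [c [d [s' [t' [_ E [ab st cd ts] [ad cb]]]]]]]]]] := C.
exfalso.
move: (contact_ge0 c1 ap) (contact_ge0 c2 ap) (contact_ge0 c3 ap') (contact_ge0 c4 ap') => /=.
expand E p => e1 e2 e3 e4.
have y0 : hV S p = 0 by lra.
by move: e2 e4; rewrite y0; lra.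
Qed.

Lemma NR_LL X S m m' m'' : config X S -> barycentric m -> barycentric m' ->
  NR S m -> LR (mirror S) m' -> LR S m'' -> tangent m m' -> interiors_meet m m'.
Proof.
wlog [c3 c4] : X S / contact m' (hU S) (lU S) (rU S) /\ contact m' (lV S) (hV S) (rV S).
  move=> W C bm bm' N [H H'|[H1 H2] H']; first by apply: (W X S) => //; left.
  apply: (W X (swap S)) => //;
    [exact: config_swap|exact: NR_swap|by left|exact: LR_swap].
move=> C bm bm' [c1 c2] _ L [p [ap ap']].
have C' := config_mirror C.
have [q [w [rq lq rw lw]]] := apex_exists C.
have [a [b [s [t [c [d [s' [t' [[_ _ sj _] E [ab st cd ts] [ad cb]]]]]]]]]] := C.
(* The triangle [m''] has a contact on the line between [b] and [d]. *)
have bd : b != d.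
  apply/eqP => bd; case: L => [[k1 k2]|[k1 k2]];
  have [r [ar]] := contact_point k1;
  move: (contact_ge0 k2 ar); expand E r => e1 e2 e3;
  (have y0 : hV S r = 0 by lra); move: e1 e3; rewrite y0; lra.
have [p1 [ap1 gp1 hp1 _]] := contact_point c1.
have [q1 [aq1 gq1 hq1 lq1]] := contact_point c2.
have I1 := contact_ge0 c1 aq1; have I2 := contact_ge0 c2 ap1.
have rp := contact_ge0 c2 ap.
have lp := contact_ge0 c4 ap'.
have [EU1 ER1 EL1 ERV1 ELV1] := E p1; have [EU2 ER2 EL2 ERV2 ELV2] := E q1.
have [EU3 ER3 EL3 ERV3 ELV3] := E p; have [EU4 ER4 EL4 ERV4 ELV4] := E q.
have D1 : d - b + (s' - s) * hV S p1 <= 0 by lra.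
have D2 : 0 <= d - b + (s' - s) * hV S q1 by lra.
have ss : s' - s < 0.
  rewrite ltNge; apply/negP => s0; case/eqP: bd; nra.
have yq1 : hV S q < hV S q1 by nra.
have ypq : hV S p <= hV S q by nra.
(* [rU - rV] is [d - b + (s' - s) * hV], which decreases with the height; it is compared at [q1],
   [q] and [p], from top to bottom. *)
have rUq : 0 < rU S q by nra.
have rUp : rU S q + rV S p <= rU S p by nra.
have [z2 [x2 y2]] := sj b 0.
have [_ e5 _ e6 _] := E z2.
have f2 : rU S z2 = 0 by rewrite e5 x2 y2; ring.
have g2 : rV S z2 != 0 by rewrite e6 x2 y2 mulr0 subr0 subr_eq0.
have [i [j [l [k [k' [[ji li lj k0 k0'] Hi Hj Hl H]]]]]] := two_facets bm c1 c2 f2 g2.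
have lp0 := at_most_one_zero_ge0 ap l.
have jl0 : rV S p = 0 -> 0 < m l p.
  by move=> r0; apply: (at_most_one_zero_gt0 (i := j) ap); rewrite ?Hj ?r0 ?mulr0 // eq_sym.
rewrite Hl in lp0; rewrite Hl in jl0.
have lq0 : 0 < 1 - k * rU S q.
  have [r0|rn] := eqVneq (rV S p) 0.
    by have := jl0 r0; rewrite r0; nra.
  have r0 : 0 < rV S p by rewrite lt_def rn.
  have : 0 < k' * rV S p by exact: mulr_gt0.
  nra.
have iq0 : 0 < k * rU S q by exact: mulr_gt0.
apply: (enters_meet (p := q) (q := w)) => //.
  move=> n; have [->|->|->] := H n.
  - by rewrite Hi; split; [exact: ltW|move=> Z; rewrite Z ltxx in iq0].
  - by rewrite !Hj rq mulr0; split=> // _; exact: mulr_gt0.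
  - by rewrite Hl rq mulr0 subr0; split; [exact: ltW|move=> Z; rewrite Z ltxx in lq0].
exact: (apex_enters C' bm' c3 c4 ap' rp lq rq lw).
Qed.

(** * Reduction of abutting triangles to the configuration *)

Lemma mirrorK : involutive mirror.
Proof. by case. Qed.

Lemma contact_sym m g (h h' : plane -> R) : contact m g h h' -> contact m g h' h.
Proof.
by move=> [i [k [p [k0 H gp Hp [hp hp']]]]]; exists i, k, p; split.
Qed.

Definition opposite_to m i h := exists2 c, 0 < c & forall z, h z = - c * m i z.

Definition outer_sides m h r l := exists i j n,
  [/\ uniq [:: i; j; n], forall o, [\/ o = i, o = j | o = n],
      opposite_to m i h, opposite_to m j r & opposite_to m n l].

Lemma abut_contact m m' h r l : outer_sides m' h r l -> abut m m' ->
  [\/ contact m h r l, contact m r h l | contact m l h r].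
Proof.
move=> [i [j [n [/= + H [ci ci0 Hi] [cj cj0 Hj] [cn cn0 Hn]]]]].
rewrite !inE negb_or !andbT => /andP[/andP[ij ni] jn].
move=> [i' [j' [k [p [k0 E ip Hi' Hj']]]]].
have jp : m' j' p = 0.
  have := E p; rewrite ip => /esym/eqP; rewrite mulf_eq0 oppr_eq0 gt_eqF //=.
  by move/eqP.
have contact_of_facet o c g h1 h2 : o = j' -> 0 < c -> (forall z, g z = - c * m' o z) ->
    h1 p < 0 -> h2 p < 0 -> contact m g h1 h2.
  move=> -> c0 Hg h1p h2p; exists i', (k / c), p; split=> //.
  - exact: divr_gt0.
  - by move=> z; rewrite E Hg; field; rewrite gt_eqF.
  - by rewrite Hg jp mulr0.
have neg o c g : o != j' -> 0 < c -> (forall z, g z = - c * m' o z) -> g p < 0.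
  by move=> oj c0 ->; rewrite mulNr oppr_lt0 mulr_gt0 // Hj'.
have [j'E|j'E|j'E] := H j'; [constructor 1|constructor 2|constructor 3].
- by apply: (contact_of_facet i ci); rewrite ?j'E //;
    [apply: (neg j cj)|apply: (neg n cn)]; rewrite // j'E eq_sym.
- by apply: (contact_of_facet j cj); rewrite ?j'E //;
    [apply: (neg i ci)|apply: (neg n cn)]; rewrite // j'E // eq_sym.
- by apply: (contact_of_facet n cn); rewrite ?j'E //;
    [apply: (neg i ci)|apply: (neg j cj)]; rewrite // j'E.
Qed.

(** Coordinates are taken from U: [X] is [m i1] and the height is [m i], so that U becomes the
    standard triangle with [a = 0], [b = 1], [s = -1], [t = 0]. *)
Lemma abut_config m m' : barycentric m -> barycentric m' -> abut m m' ->
  exists X S, [/\ config X S, outer_sides m (hU S) (rU S) (lU S)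
    & outer_sides m' (hV S) (rV S) (lV S)].
Proof.
move=> bm bm' [i [j [k [p [k0 E ip Hi Hj]]]]].
have [i1 [i2 [i1i i2i i12 I]]] := ord3_others i.
have [j1 [j2 [j1j j2j j12 J]]] := ord3_others j.
have [am _ _ inj] := bm; have [am' _ _ _] := bm'.
have mi2 z := bary_sum3 z bm i1i i2i i12.
have coord o : exists B A G, forall z, m' o z = B * m i1 z + A * m i z + G.
  have [al [be [ga H]]] := bary_expand bm i1i i2i i12 (am' o).
  by exists (be - ga), (al - ga), ga => z; rewrite H mi2; ring.
(* The left side of V is the one whose coordinate increases with [X]. Since the coordinates sum to
   1, exchanging [j1] and [j2] changes the sign of [B]; [B = 0] would make [m' j1] constant on the
   common line. *)
wlog [B [A [G [B0 H1]]]] : j1 j2 j1j j2j j12 J / exists B A G, 0 < B /\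
    forall z, m' j1 z = B * m i1 z + A * m i z + G.
  move=> W; have [B [A [G H]]] := coord j1.
  have mj2 z := bary_sum3 z bm' j1j j2j j12.
  have mj z : m' j z = - k^-1 * m i z by rewrite E; field; rewrite gt_eqF.
  have [B0|B0|B0] := ltgtP 0 B.
  - by apply: (W j1 j2) => //; exists B, A, G.
  - apply: (W j2 j1) => //; first by rewrite eq_sym.
      by move=> o; have [] := J o; [constructor 1|constructor 3|constructor 2].
    exists (- B), (- A + k^-1), (1 - G); split; first lra.
    by move=> z; rewrite mj2 mj H; ring.
  - have [z [zj zj1 _]] := bary_point 0 (G + 1) bm' j1j j2j j12.
    move: zj1; rewrite H -B0 (_ : m i z = 0); last by rewrite E zj mulr0.
    by lra.
have mj2 z : m' j2 z = 1 + k^-1 * m i z - (B * m i1 z + A * m i z + G).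
  rewrite (bary_sum3 z bm' j1j j2j j12) H1 E; field; by rewrite gt_eqF.
have Bn0 : B != 0 by rewrite gt_eqF.
(* The lines [m' j1 = 0] and [m' j2 = 0], solved for [X]. *)
pose c := - G / B; pose t' := - A / B.
pose d := (1 - G) / B; pose s' := (k^-1 - A) / B.
exists (m i1), (Sides (\- m i) (fun z => - m i2 z) (fun z => - m i1 z) (m i)
  (fun z => m i1 z - d - s' * m i z) (fun z => c + t' * m i z - m i1 z)).
have x0 := Hi _ i1i; have x1 := Hi _ i2i; rewrite mi2 ip in x1.
have y1 := Hj _ j1j; have y2 := Hj _ j2j; rewrite mj2 ip in y2.
rewrite H1 ip in y1.
split.
- exists 0, 1, (-1), 0, c, d, s', t'; split.
  + split=> //=.
      move=> x y; have [z [zi zi1 _]] := bary_point y x bm i1i i2i i12.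
      by exists z.
    move=> z w z1 z2; apply: inj => o.
    by have [->|->|->] := I o; rewrite ?mi2 ?z1 ?z2.
  + by move=> z; split=> //=; rewrite ?mi2; ring.
  + split; [lra|lra| |].
      by rewrite /c /d ltr_pM2r ?invr_gt0 //; lra.
    rewrite /t' /s' ltr_pM2r ?invr_gt0 //.
    have : 0 < k^-1 by rewrite invr_gt0.
    lra.
  + split; last by rewrite /c ltr_pdivrMr //; nra.
    by rewrite /d divr_gt0 //; nra.
- exists i, i2, i1; split=> /=.
  + by rewrite !inE negb_or !andbT (eq_sym i) i2i (eq_sym i) i1i.
  + by move=> o; have [] := I o; [constructor 1|constructor 3|constructor 2].
  + by exists 1 => // z /=; ring.
  + by exists 1 => // z /=; ring.
  + by exists 1 => // z /=; ring.
- exists j, j2, j1; split=> /=.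
  + by rewrite !inE negb_or !andbT (eq_sym j) j2j (eq_sym j) j1j.
  + by move=> o; have [] := J o; [constructor 1|constructor 3|constructor 2].
  + by exists k.
  + exists B^-1; first by rewrite invr_gt0.
    by move=> z /=; rewrite mj2 /d /s'; field; rewrite gt_eqF //= Bn0.
  + exists B^-1; first by rewrite invr_gt0.
    by move=> z /=; rewrite H1 /c /t'; field.
Qed.

Lemma contact_classes X S m : config X S ->
  [\/ contact m (hU S) (rU S) (lU S), contact m (rU S) (hU S) (lU S)
    | contact m (lU S) (hU S) (rU S)] ->
  [\/ contact m (hV S) (rV S) (lV S), contact m (rV S) (hV S) (lV S)
    | contact m (lV S) (hV S) (rV S)] ->
  [\/ LR S m, LR (mirror S) m, NR S m | NR (mirror S) m].
Proof.
move=> C [cU|cU|cU] [cV|cV|cV].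
- by case: (contact_hUhV C cU cV).
- by constructor 1; left.
- by constructor 2; left; split=> //; exact: contact_sym.
- by constructor 1; right.
- by constructor 3.
- by case: (contact_rUlV C cU cV).
- by constructor 2; right; split=> //; exact: contact_sym.
- by case: (contact_rUlV (config_mirror C) cU cV).
- by constructor 4.
Qed.

End Triangles.

(** * Counting vertices and edges from the three kinds *)

Section Counting.
Variables (V : finType) (adj : rel V) (C : {set V}) (A B N : V -> Prop).
Hypothesis adj_irr : irreflexive adj.
Hypothesis adj_sym : symmetric adj.
Hypothesis A1 : forall x y, A x -> A y -> x = y.
Hypothesis B1 : forall x y, B x -> B y -> x = y.
Hypothesis N1 : forall x y, N x -> N y -> x = y.
Hypothesis cover : forall x, x \in C -> [\/ A x, B x | N x].

Lemma card_cover3 : (#|C| <= 3)%N.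
Proof.
have le1 (P : V -> Prop) : (forall x y, P x -> P y -> x = y) ->
    (#|[set x | `[< P x >]]%SET| <= 1)%N.
  move=> P1; apply/card_le1_eqP => x y; rewrite !finset.in_set => /asboolP Px /asboolP Py.
  exact: P1.
have S : C \subset ([set x | `[< A x >]] :|: [set x | `[< B x >]]
    :|: [set x | `[< N x >]])%SET.
  apply/fintype.subsetP => x /cover; rewrite !inE => H.
  by case: H => [/asboolP ->|/asboolP ->|/asboolP ->]; rewrite ?orbT.
apply: leq_trans (subset_leq_card S) _.
apply: leq_trans (leq_card_setU _ _) _.
rewrite -[3%N]/(1 + 1 + 1)%N leq_add ?le1 //.
by apply: leq_trans (leq_card_setU _ _) _; rewrite leq_add ?le1.
Qed.

(** Every edge contains the vertex of kind [N], and that vertex cannot be adjacent to both other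
    kinds. *)
Lemma card_edges_cover3 :
  (forall x y, A x -> B y -> ~ adj x y) ->
  (forall x y z, N x -> A y -> B z -> adj x y -> adj x z -> False) ->
  (#|[set [set x; y] | x in C, y in C & adj x y]%SET| <= 1)%N.
Proof.
move=> AB NAB.
have edge e : e \in [set [set x; y] | x in C, y in C & adj x y]%SET ->
    exists x y, [/\ e = [set x; y]%SET, N x, A y \/ B y & adj x y].
  move=> /imset2P[x y xC]; rewrite inE => /andP[yC axy] ->.
  have ayx : adj y x by rewrite adj_sym.
  have ne : x <> y by move=> xy; rewrite xy adj_irr in axy.
  case: (cover xC) (cover yC) => Hx [] Hy.
  - by case: ne; exact: A1.
  - by case: (AB _ _ Hx Hy).
  - by exists y, x; split=> //; [rewrite finset.setUC|left].
  - by case: (AB _ _ Hy Hx).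
  - by case: ne; exact: B1.
  - by exists y, x; split=> //; [rewrite finset.setUC|right].
  - by exists x, y; split=> //; left.
  - by exists x, y; split=> //; right.
  - by case: ne; exact: N1.
apply/card_le1_eqP => e' e /edge[x [y [-> Nx Hy axy]]] /edge[x' [y' [-> Nx' Hy' axy']]].
have xx := N1 Nx' Nx; rewrite xx in axy' *.
suff -> : y = y' by [].
case: Hy Hy' => Hy [] Hy'; [exact: A1| | |exact: B1].
- by case: (NAB _ _ _ Nx Hy Hy').
- by case: (NAB _ _ _ Nx Hy' Hy).
Qed.

End Counting.

Theorem theorem4 (R : realType) (V : finType) (adj : rel V)
    (adj_sym : symmetric adj) (adj_irr : irreflexive adj)
    (hG : @has_touching_triangles_rep R V adj)
    (u v : V) (huv : adj u v) :
  (#|common_neighbors adj u v| <= 3)%N /\ (#|common_edges adj u v| <= 1)%N.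
Proof.
have [T [_ triT disjT adjT]] := hG.
have [m Hm] := choice (fun x => triangle_barycentric (triT x)).
have bm x : barycentric (m x) by have [] := Hm x.
have neq x y : adj x y -> x != y by apply: contraTneq => ->; rewrite adj_irr.
have nomeet x y : x != y -> ~ interiors_meet (m x) (m y).
  move=> xy [z Hz]; suff : ((T x)° `&` (T y)°) z by rewrite (disjT _ _ xy).
  by split; [apply: (triangle_interior (bm x) (Hm x).2)
    |apply: (triangle_interior (bm y) (Hm y).2)] => i; case: (Hz i).
have meet_eq x y : interiors_meet (m x) (m y) -> x = y.
  by move=> H; apply/eqP/contraT => /nomeet.
have abuts x y : adj x y -> abut (m x) (m y).
  move=> axy; have xy := neq _ _ axy.
  exact: (touch_abut (bm x) (bm y) (Hm x).2 (Hm y).2 (nomeet _ _ xy) ((adjT _ _ xy).1 axy)).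
have [X [S [C outU outV]]] := abut_config (bm u) (bm v) (abuts _ _ huv).
have C' := config_mirror C.
pose A x := LR S (m x); pose B x := LR (mirror S) (m x).
(* Right and left versions form one kind, as they exclude each other by [NR_NL]. *)
pose N x := NR S (m x) \/ NR (mirror S) (m x).
have A1 x y : A x -> A y -> x = y.
  by move=> Ax Ay; apply/meet_eq/(LR_unique C).
have B1 x y : B x -> B y -> x = y.
  by move=> Bx By; apply/meet_eq/(LR_unique C').
have N1 x y : N x -> N y -> x = y.
  move=> [Nx|Nx] [Ny|Ny]; [|by case: (NR_NL C Nx Ny)|by case: (NR_NL C Ny Nx)|].
  - exact/meet_eq/(NR_unique C).
  - exact/meet_eq/(NR_unique C').
have cover x : x \in common_neighbors adj u v -> [\/ A x, B x | N x].
  rewrite !inE => /andP[ux vx].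
  rewrite adj_sym in ux; rewrite adj_sym in vx.
  have := contact_classes C (abut_contact outU (abuts _ _ ux)) (abut_contact outV (abuts _ _ vx)).
  by case; [constructor 1|constructor 2|constructor 3; left|constructor 3; right].
split; first exact: (card_cover3 A1 B1 N1 cover).
apply: (card_edges_cover3 adj_irr adj_sym A1 B1 N1 cover).
  move=> x y Ax By axy; have /eqP := neq _ _ axy; apply.
  exact: (meet_eq _ _ (LR_LL C (bm x) (bm y) Ax By (abut_tangent (abuts _ _ axy)))).
move=> x y z [Nx|Nx] Ay Bz axy axz.
  have /eqP := neq _ _ axz; apply.
  exact: (meet_eq _ _ (NR_LL C (bm x) (bm z) Nx Bz Ay (abut_tangent (abuts _ _ axz)))).
(* Seen in the mirror, the neighbor of kind [A] is the one at the opposite end. *)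
rewrite /A -[S]mirrorK in Ay.
have /eqP := neq _ _ axy; apply.
exact: (meet_eq _ _ (NR_LL C' (bm x) (bm y) Nx Ay Bz (abut_tangent (abuts _ _ axy)))).
Qed.
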